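(* Let $E\subsetneq\partial\mathbb{D}$ be a closed set. Then there exists a one-component bounded function $b$ such that $\mathrm{spec}(b)=E$.
   Context: $\mathbb{D}$ is the open unit disc and $H^\infty(\mathbb{D})$ the bounded analytic functions on $\mathbb{D}$, $\|b\|_\infty=\sup_{\mathbb{D}}|b|$. For $b\in H^\infty(\mathbb{D})$ with $\|b\|_\infty=1$, the spectrum of $b$ is $\mathrm{spec}(b)=\{\xi\in\partial\mathbb{D}: \liminf_{z\to\xi, z\in\mathbb{D}}|b(z)|<1\}$. Such a $b$ is called one-component (a one-component bounded function) if there is a constant $0<C<1$ such that (a) $\mathrm{spec}(b)\subseteq\overline{\{z\in\mathbb{D}:|b(z)|\le C\}}$ and (b) the set $\{z\in\mathbb{D}:|b(z)|<C\}$ is connected. *)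

(* Defs.v *)
From Stdlib Require Import Reals.
From Coquelicot Require Import Coquelicot.
Open Scope R_scope.

Definition in_disc (z : C) : Prop := Cmod z < 1.

Definition holomorphic_on_disc (b : C -> C) : Prop :=
  forall z : C, in_disc z -> exists l : C, @is_derive C_AbsRing C_NormedModule b z l.

Definition sup_norm_one (b : C -> C) : Prop :=
  (forall z, in_disc z -> Cmod (b z) <= 1) /\
  (forall eps, 0 < eps -> exists z, in_disc z /\ 1 - eps < Cmod (b z)).

(* spec(b) = { xi in dD : liminf_{z -> xi, z in D} |b(z)| < 1 }, with the liminf
   condition unfolded: some c < 1 is undercut by |b| in every D-neighbourhood of xi. *)
Definition spec (b : C -> C) (xi : C) : Prop :=
  Cmod xi = 1 /\
  exists c : R, c < 1 /\
    forall delta, 0 < delta ->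
      exists z, in_disc z /\ Cmod (z - xi) < delta /\ Cmod (b z) < c.

(* Topological connectedness of a subset A of C (empty set counts as connected). *)
Definition connected_set (A : C -> Prop) : Prop :=
  ~ exists U V : C -> Prop,
      open U /\ open V /\
      (forall z, A z -> U z \/ V z) /\
      (exists z, A z /\ U z) /\ (exists z, A z /\ V z) /\
      (forall z, A z -> U z -> V z -> False).

Definition in_closure (A : C -> Prop) (xi : C) : Prop :=
  forall delta, 0 < delta -> exists z, A z /\ Cmod (z - xi) < delta.

(* One-component bounded function (b is assumed in H^oo with ||b||_oo = 1). *)
Definition one_component (b : C -> C) : Prop :=
  exists Cc : R, 0 < Cc /\ Cc < 1 /\
    (forall xi, spec b xi ->
        in_closure (fun z => in_disc z /\ Cmod (b z) <= Cc) xi) /\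
    connected_set (fun z => in_disc z /\ Cmod (b z) < Cc).

(* Main.v *)
(** The case of empty [E] is settled by the constant [1].  Otherwise a point [a] of the circle
    outside [E] is sent to infinity by a Cayley transform; [E] becomes a compact set
    [A] of the real line, contained in [[-K, K]].  Let [p] be a nearest-point map onto [A] and
    [u (x + iy)] the integral of [y / ((x - p s)^2 + y^2)] over [s] in [[-K, K]], a positive harmonic
    function, the Poisson integral of the image of Lebesgue measure under [p].  Then
    [b = exp (- (u + i v))] is the required function, with threshold [exp (- 1/20)].

    - [u] tends to [0] at every boundary point outside [A], infinity included.
    - [u >= 1/10] whenever [|x| <= K] and [d (x, A) <= y <= 2K], because [p] moves the points at
      distance at most [y] from [x] by at most [2y].
    - [{u > 1/20}] is connected: [u] increases along horizontal motion towards [[-K, K]], along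
      upward motion as long as [y <= d (x, A)], and along downward motion as long as [y >= 2K];
      so every point is joined to the segment [y = 2K], [|x| <= K] inside the set. *)

Require Import Defs.
From Stdlib Require Import Reals Lra Lia Psatz Classical ClassicalEpsilon.
From Coquelicot Require Import Coquelicot.
Open Scope R_scope.

(** * Riemann integrability of monotone functions *)

Definition nondecreasing (f : R -> R) : Prop := forall s t, s <= t -> f s <= f t.

Definition step_ge (c v : R) : R := if Rle_dec c v then 1 else 0.

(** By monotonicity the points of [[a, b]] with [f s < c] form an initial piece of the interval, so
    the integrand is [0] before the supremum [m] of that piece and [1] after it. *)
Lemma ex_RInt_step_ge (f : R -> R) (c a b : R) :
  nondecreasing f -> a <= b -> ex_RInt (fun s => step_ge c (f s)) a b.
Proof.
  intros Hf Hab.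
  destruct (classic (exists s, a <= s <= b /\ f s < c)) as [[s0 [Hs0 Hfs0]]|Hno].
  - destruct (completeness (fun s => a <= s <= b /\ f s < c)) as [m [Hm1 Hm2]].
    { exists b. intros x [Hx _]. lra. }
    { now exists s0. }
    assert (Ham : a <= m) by (specialize (Hm1 s0 (conj Hs0 Hfs0)); lra).
    assert (Hmb : m <= b) by (apply Hm2; intros x [Hx _]; lra).
    apply ex_RInt_Chasles with m.
    + apply ex_RInt_ext with (fun _ => 0); [|apply ex_RInt_const].
      intros x. rewrite Rmin_left, Rmax_right by lra. intros Hx.
      unfold step_ge. destruct (Rle_dec c (f x)) as [Hc|]; [|easy].
      exfalso. assert (m <= x); [|lra].
      apply Hm2. intros y [Hy1 Hy2]. apply Rnot_lt_le. intros Hxy.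
      specialize (Hf x y). lra.
    + apply ex_RInt_ext with (fun _ => 1); [|apply ex_RInt_const].
      intros x. rewrite Rmin_left, Rmax_right by lra. intros Hx.
      unfold step_ge. destruct (Rle_dec c (f x)) as [|Hc]; [easy|].
      exfalso. assert (x <= m); [|lra].
      apply Hm1. lra.
  - apply ex_RInt_ext with (fun _ => 1); [|apply ex_RInt_const].
    intros x. rewrite Rmin_left, Rmax_right by lra. intros Hx.
    unfold step_ge. destruct (Rle_dec c (f x)) as [|Hc]; [easy|].
    exfalso. apply Hno. exists x. lra.
Qed.

(** For [0 <= v] and [0 < d] this is [v] rounded down to a multiple of [d], capped at [n * d]; as a
    sum of steps its composition with a monotone map is integrable. *)
Fixpoint stairs (d : R) (n : nat) (v : R) : R :=
  match n with
  | O => 0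
  | S m => stairs d m v + d * step_ge (INR (S m) * d) v
  end.

Lemma stairs_top (d v : R) (n : nat) :
  0 < d -> INR n * d <= v -> stairs d n v = INR n * d.
Proof.
  intros Hd. induction n as [|n IH]; intros Hv.
  - simpl. ring.
  - cbn [stairs]. rewrite IH by (rewrite S_INR in Hv; nra).
    unfold step_ge. destruct (Rle_dec (INR (S n) * d) v); [|lra].
    rewrite S_INR. ring.
Qed.

(** The range reaches [(n + 1) * d], one step above the cap, because the top stair still
    approximates the values in the last interval. *)
Lemma stairs_approx (d v : R) (n : nat) :
  0 < d -> 0 <= v <= INR (S n) * d -> stairs d n v <= v <= stairs d n v + d.
Proof.
  intros Hd. induction n as [|n IH]; intros Hv.
  - simpl in *. lra.
  - destruct (Rle_dec (INR (S n) * d) v) as [H|H].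
    + rewrite stairs_top by easy. rewrite S_INR in Hv. lra.
    + cbn [stairs]. unfold step_ge.
      destruct (Rle_dec (INR (S n) * d) v); [easy|]. lra.
Qed.

Lemma ex_RInt_stairs (f : R -> R) (d a b : R) (n : nat) :
  nondecreasing f -> a <= b -> ex_RInt (fun s => stairs d n (f s)) a b.
Proof.
  intros Hf Hab. induction n as [|n IH]; cbn [stairs].
  - apply ex_RInt_const.
  - apply (ex_RInt_plus (fun s => stairs d n (f s))); [easy|].
    apply (ex_RInt_scal (fun s => step_ge (INR (S n) * d) (f s)) a b d).
    now apply ex_RInt_step_ge.
Qed.

(** Integrability passes to uniform limits; choice picks an integrable [g n] within [1 / (n + 1)] of
    [f]. *)
Lemma ex_RInt_uniform_approx (f : R -> R) (a b : R) :
  (forall eps, 0 < eps ->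
     exists g, ex_RInt g a b /\ forall s, Rabs (g s - f s) < eps) ->
  ex_RInt f a b.
Proof.
  intros H.
  assert (Hn : forall n : nat, 0 < / INR (S n)).
  { intros n. apply Rinv_0_lt_compat, lt_0_INR. lia. }
  set (g := fun n => proj1_sig (constructive_indefinite_description _ (H _ (Hn n)))).
  assert (Hg : forall n, ex_RInt (g n) a b /\ forall s, Rabs (g n s - f s) < / INR (S n)).
  { intros n. unfold g. now destruct (constructive_indefinite_description _ (H _ (Hn n))). }
  destruct (filterlim_RInt g a b eventually _ f (fun n => RInt (g n) a b)) as [I [_ HI]].
  - intros n. apply (RInt_correct (g n)), Hg.
  - apply filterlim_locally. intros eps.
    destruct (archimed_cor1 eps (cond_pos eps)) as [N [HN HN0]].
    exists N. intros n Hle s.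
    destruct (Hg n) as [_ Hgn]. specialize (Hgn s).
    change (Rabs (g n s - f s) < eps).
    apply Rlt_trans with (1 := Hgn). apply Rle_lt_trans with (2 := HN).
    apply Rinv_le_contravar; [now apply lt_0_INR|]. apply le_INR. lia.
  - now exists I.
Qed.

Lemma ex_RInt_nondecreasing (f : R -> R) (M a b : R) :
  nondecreasing f -> (forall s, Rabs (f s) <= M) -> a <= b -> ex_RInt f a b.
Proof.
  intros Hf HM Hab. apply ex_RInt_uniform_approx. intros eps Heps.
  (* The staircase errs by at most [d]; halving [eps] makes the final inequality strict. *)
  pose (d := eps / 2).
  (* The shifted function [f + M] takes values in [[0, 2M]], and [n] stairs of height [d] must cover
     that range. *)
  destruct (INR_unbounded (2 * M / d)) as [n Hn].
  exists (fun s => stairs d n (f s + M) + - M). split.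
  - apply (ex_RInt_plus (fun s => stairs d n (f s + M))); [|apply ex_RInt_const].
    apply (ex_RInt_stairs (fun s => f s + M)); [|easy].
    intros s t Hst. specialize (Hf s t Hst). lra.
  - intros s. assert (Hd : 0 < d) by (unfold d; lra).
    assert (HMn : 2 * M < INR n * d).
    { apply Rmult_lt_reg_r with (/ d); [now apply Rinv_0_lt_compat|].
      replace (INR n * d * / d) with (INR n) by (field; lra). exact Hn. }
    assert (Hs := HM s). apply Rabs_le_between in Hs.
    destruct (stairs_approx d (f s + M) n Hd) as [H1 H2].
    { rewrite S_INR. lra. }
    unfold d in *. apply Rabs_def1; lra.
Qed.

(** * Nearest-point maps and integration against their image measure *)

Definition nearest_point_map (A : R -> Prop) (p : R -> R) : Prop :=
  forall s, A (p s) /\ forall t, A t -> Rabs (s - p s) <= Rabs (s - t).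

(** A nearest point can only be [s - d] or [s + d], where [d] is the distance from [s] to [A]. If
    both were outside the closed set [A], small balls around them would miss [A], yet [A] has points
    whose distance to [s] is arbitrarily close to [d]. *)
Lemma nearest_point_map_exists (A : R -> Prop) :
  (exists t, A t) -> closed A -> exists p, nearest_point_map A p.
Proof.
  intros [t0 Ht0] HA.
  assert (H : forall s, exists q, A q /\ forall t, A t -> Rabs (s - q) <= Rabs (s - t)).
  { intros s.
    (* The infimum of the distances is obtained as minus the supremum of their opposites. *)
    destruct (completeness (fun r => exists t, A t /\ r = - Rabs (s - t))) as [m [Hm1 Hm2]].
    { exists 0. intros r [t [_ ->]]. generalize (Rabs_pos (s - t)). lra. }
    { exists (- Rabs (s - t0)). now exists t0. }
    set (d := - m).
    assert (Hd : forall t, A t -> d <= Rabs (s - t)).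
    { intros t Ht. assert (- Rabs (s - t) <= m) by (apply Hm1; now exists t).
      unfold d. lra. }
    assert (Hd' : forall eps, 0 < eps -> exists t, A t /\ Rabs (s - t) < d + eps).
    { intros eps Heps. apply NNPP. intros Hn.
      assert (m <= m - eps); [|lra].
      apply Hm2. intros r [t [Ht ->]].
      apply Rnot_lt_le. intros Hlt. apply Hn. exists t. split; [easy|].
      unfold d. lra. }
    assert (Hcase : A (s - d) \/ A (s + d)).
    { apply NNPP. intros Hn. apply not_or_and in Hn. destruct Hn as [Hn1 Hn2].
      assert (H1 : locally (s - d) (fun t => ~ A t)).
      { apply NNPP. intros Hc. now apply Hn1, HA. }
      assert (H2 : locally (s + d) (fun t => ~ A t)).
      { apply NNPP. intros Hc. now apply Hn2, HA. }
      destruct H1 as [e1 H1]. destruct H2 as [e2 H2].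
      assert (He1 := cond_pos e1). assert (He2 := cond_pos e2).
      destruct (Hd' (Rmin e1 e2)) as [t [Ht Hlt]].
      { now apply Rmin_glb_lt. }
      assert (Hge := Hd t Ht).
      assert (Hm := Rmin_l e1 e2). assert (Hm' := Rmin_r e1 e2).
      destruct (Rle_dec t s) as [Hts|Hts].
      - rewrite Rabs_pos_eq in Hlt, Hge by lra.
        apply (H1 t); [|easy].
        change (Rabs (t - (s - d)) < e1). apply Rabs_def1; lra.
      - rewrite Rabs_left1 in Hlt, Hge by lra.
        apply (H2 t); [|easy].
        change (Rabs (t - (s + d)) < e2). apply Rabs_def1; lra. }
    assert (Hd0 : 0 <= d).
    { apply Rnot_lt_le. intros Hlt. destruct (Hd' (- d)) as [t [_ Ht]]; [lra|].
      generalize (Rabs_pos (s - t)). lra. }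
    destruct Hcase as [Hc|Hc]; [exists (s - d)|exists (s + d)]; split; try easy;
      intros t Ht; specialize (Hd t Ht).
    - replace (s - (s - d)) with d by ring. now rewrite Rabs_pos_eq.
    - replace (s - (s + d)) with (- d) by ring. now rewrite Rabs_Ropp, Rabs_pos_eq. }
  exists (fun s => proj1_sig (constructive_indefinite_description _ (H s))).
  intros s. now destruct (constructive_indefinite_description _ (H s)).
Qed.

(** Squaring and adding the two minimality inequalities gives [(t - s) * (p s - p t) <= 0], so the
    order cannot be reversed. *)
Lemma nearest_point_map_nondecreasing (A : R -> Prop) (p : R -> R) :
  nearest_point_map A p -> nondecreasing p.
Proof.
  intros Hp s t Hst. apply Rnot_lt_le. intros Hlt.
  destruct (Hp s) as [HAs Hs]. destruct (Hp t) as [HAt Ht].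
  specialize (Hs _ HAt). specialize (Ht _ HAs).
  destruct (Req_dec s t) as [->|Hne]; [lra|].
  apply Rsqr_le_abs_1 in Hs, Ht. unfold Rsqr in Hs, Ht. nra.
Qed.

Definition bounded_monotone (K : R) (p : R -> R) : Prop :=
  0 < K /\ nondecreasing p /\ forall s, Rabs (p s) <= K.

(* [phi (p s) + L * p s] is nondecreasing, so [phi o p] is a difference of monotone functions. *)
Lemma ex_RInt_lipschitz_monotone (phi p : R -> R) (K L a b : R) :
  bounded_monotone K p -> (forall s t, Rabs (phi s - phi t) <= L * Rabs (s - t)) ->
  a <= b -> ex_RInt (fun s => phi (p s)) a b.
Proof.
  intros [HK [Hp Hb]] Hphi Hab.
  assert (HL : 0 <= L).
  { specialize (Hphi 1 0). rewrite Rminus_0_r, Rabs_R1 in Hphi.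
    generalize (Rabs_pos (phi 1 - phi 0)). lra. }
  apply ex_RInt_ext with (fun s => (phi (p s) + L * p s) - L * p s).
  { intros s _. change ((phi (p s) + L * p s) - L * p s = phi (p s)). ring. }
  apply (ex_RInt_minus (fun s => phi (p s) + L * p s) (fun s => L * p s)).
  - apply ex_RInt_nondecreasing with (Rabs (phi 0) + 2 * L * K); [| |easy].
    + intros s t Hst. specialize (Hp s t Hst). specialize (Hphi (p s) (p t)).
      rewrite (Rabs_left1 (p s - p t)) in Hphi by lra.
      apply Rabs_le_between in Hphi. lra.
    + intros s. specialize (Hb s). specialize (Hphi (p s) 0). rewrite Rminus_0_r in Hphi.
      assert (L * Rabs (p s) <= L * K) by now apply Rmult_le_compat_l.
      replace (phi (p s) + L * p s) with (phi 0 + ((phi (p s) - phi 0) + L * p s)) by ring.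
      eapply Rle_trans; [apply Rabs_triang|].
      assert (Hn := Rabs_triang (phi (p s) - phi 0) (L * p s)).
      rewrite (Rabs_mult L), (Rabs_pos_eq L HL) in Hn. lra.
  - apply ex_RInt_nondecreasing with (L * K); [| |easy].
    + intros s t Hst. apply Rmult_le_compat_l; auto.
    + intros s. rewrite Rabs_mult, (Rabs_pos_eq L) by easy. now apply Rmult_le_compat_l.
Qed.

Definition Clipschitz (g : R -> C) : Prop :=
  exists L, forall s t, Cmod (g s - g t) <= L * Rabs (s - t).

Lemma fst_le_Cmod (z : C) : Rabs (fst z) <= Cmod z.
Proof. eapply Rle_trans; [apply Rmax_l|apply Rmax_Cmod]. Qed.

Lemma snd_le_Cmod (z : C) : Rabs (snd z) <= Cmod z.
Proof. eapply Rle_trans; [apply Rmax_r|apply Rmax_Cmod]. Qed.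

Lemma Cmod_le_fst_snd (z : C) : Cmod z <= Rabs (fst z) + Rabs (snd z).
Proof.
  assert (Hz : z = (RtoC (fst z) + Ci * RtoC (snd z))%C).
  { destruct z as [x y]. unfold Ci, RtoC, Cplus, Cmult. simpl. f_equal; ring. }
  rewrite Hz at 1. eapply Rle_trans; [apply Cmod_triangle|].
  rewrite Cmod_mult, Cmod_Ci, !Cmod_R. lra.
Qed.

(** This is the integral of [g] against the image under [p] of Lebesgue measure on [[-K, K]], taken
    componentwise. *)
Definition cint (K : R) (p : R -> R) (g : R -> C) : C :=
  (RInt (fun s => fst (g (p s))) (- K) K, RInt (fun s => snd (g (p s))) (- K) K).

Lemma ex_RInt_fst (K a b : R) (p : R -> R) (g : R -> C) :
  bounded_monotone K p -> Clipschitz g -> a <= b ->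
  ex_RInt (fun s => fst (g (p s))) a b.
Proof.
  intros Hp [L HL] Hab.
  apply (ex_RInt_lipschitz_monotone (fun t => fst (g t)) p K L); try easy.
  intros s t. eapply Rle_trans; [|apply HL]. apply (fst_le_Cmod (g s - g t)).
Qed.

Lemma ex_RInt_snd (K a b : R) (p : R -> R) (g : R -> C) :
  bounded_monotone K p -> Clipschitz g -> a <= b ->
  ex_RInt (fun s => snd (g (p s))) a b.
Proof.
  intros Hp [L HL] Hab.
  apply (ex_RInt_lipschitz_monotone (fun t => snd (g t)) p K L); try easy.
  intros s t. eapply Rle_trans; [|apply HL]. apply (snd_le_Cmod (g s - g t)).
Qed.

Lemma cint_minus (K : R) (p : R -> R) (f g : R -> C) :
  bounded_monotone K p -> Clipschitz f -> Clipschitz g ->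
  cint K p (fun t => f t - g t)%C = (cint K p f - cint K p g)%C.
Proof.
  intros Hp Hf Hg. assert (HK : - K <= K) by (destruct Hp; lra).
  unfold cint, Cminus, Cplus, Copp. simpl. f_equal.
  - apply (RInt_minus (fun s => fst (f (p s))) (fun s => fst (g (p s))));
      eapply ex_RInt_fst; eassumption.
  - apply (RInt_minus (fun s => snd (f (p s))) (fun s => snd (g (p s))));
      eapply ex_RInt_snd; eassumption.
Qed.

Lemma cint_scal (K : R) (p : R -> R) (c : C) (g : R -> C) :
  bounded_monotone K p -> Clipschitz g ->
  cint K p (fun t => c * g t)%C = (c * cint K p g)%C.
Proof.
  intros Hp Hg. assert (HK : - K <= K) by (destruct Hp; lra).
  assert (H1 := ex_RInt_fst K (- K) K p g Hp Hg HK).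
  assert (H2 := ex_RInt_snd K (- K) K p g Hp Hg HK).
  assert (S : forall (r : R) (f : R -> R), ex_RInt f (- K) K ->
    RInt (fun s => r * f s) (- K) K = r * RInt f (- K) K).
  { intros r f Hf. apply (RInt_scal f (- K) K r Hf). }
  assert (S' : forall (r : R) (f : R -> R), ex_RInt f (- K) K ->
    ex_RInt (fun s => r * f s) (- K) K).
  { intros r f Hf. apply (ex_RInt_scal f (- K) K r Hf). }
  unfold cint, Cmult. simpl. rewrite <- !S by assumption. f_equal.
  - apply (RInt_minus (fun s => fst c * fst (g (p s))) (fun s => snd c * snd (g (p s))));
      now apply S'.
  - apply (RInt_plus (fun s => fst c * snd (g (p s))) (fun s => snd c * fst (g (p s))));
      now apply S'.
Qed.

(** The real and the imaginary part each contribute at most [B] times the length [2K]. *)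
Lemma Cmod_cint_le (K B : R) (p : R -> R) (g : R -> C) :
  bounded_monotone K p -> Clipschitz g -> (forall t, Cmod (g t) <= B) ->
  Cmod (cint K p g) <= 4 * K * B.
Proof.
  intros Hp Hg HB. assert (HK : - K <= K) by (destruct Hp; lra).
  assert (H1 := ex_RInt_fst K (- K) K p g Hp Hg HK).
  assert (H2 := ex_RInt_snd K (- K) K p g Hp Hg HK).
  eapply Rle_trans; [apply Cmod_le_fst_snd|]. unfold cint. simpl.
  assert (HR : forall f, ex_RInt f (- K) K -> (forall s, Rabs (f s) <= B) ->
    Rabs (RInt f (- K) K) <= 2 * K * B).
  { intros f Hf Hb. replace (2 * K * B) with ((K - - K) * B) by ring.
    apply abs_RInt_le_const; auto. }
  apply HR in H1.
  2:{ intros s. eapply Rle_trans; [apply fst_le_Cmod|apply HB]. }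
  apply HR in H2.
  2:{ intros s. eapply Rle_trans; [apply snd_le_Cmod|apply HB]. }
  lra.
Qed.

(** * Complex derivatives *)

Lemma is_derive_C_eps (f : C -> C) (z l : C) :
  (forall eps, 0 < eps -> exists delta, 0 < delta /\ forall h, Cmod h < delta ->
     Cmod (f (z + h) - f z - h * l)%C <= eps * Cmod h) ->
  @is_derive C_AbsRing (AbsRing_NormedModule C_AbsRing) f z l.
Proof.
  intros H. split; [apply is_linear_scal_l|].
  intros x Hx.
  apply (is_filter_lim_locally_unique (V := AbsRing_NormedModule C_AbsRing) z) in Hx. subst x.
  intros eps. destruct (H eps (cond_pos eps)) as [delta [Hdelta Hd]].
  exists (mkposreal delta Hdelta). intros y Hy.
  change (Cmod (y - z)%C < delta) in Hy.
  change (Cmod ((f y - f z) - (y - z) * l)%C <= eps * Cmod (y - z)%C).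
  specialize (Hd _ Hy). assert (Hsub : forall a b : C, (a + (b - a))%C = b) by (intros; ring).
  now rewrite (Hsub z y) in Hd.
Qed.

(** A quadratic remainder is at most [eps * Cmod h] once [Cmod h < eps / (Rabs B + 1)], whatever the
    sign of [B]. *)
Lemma is_derive_C_quadratic (f : C -> C) (z l : C) (B delta : R) :
  0 < delta ->
  (forall h, Cmod h < delta ->
     Cmod (f (z + h) - f z - h * l)%C <= B * (Cmod h * Cmod h)) ->
  @is_derive C_AbsRing (AbsRing_NormedModule C_AbsRing) f z l.
Proof.
  intros Hdelta H. apply is_derive_C_eps. intros eps Heps.
  assert (HB : 0 < Rabs B + 1) by (generalize (Rabs_pos B); lra).
  exists (Rmin delta (eps / (Rabs B + 1))). split.
  { apply Rmin_glb_lt; [easy|]. now apply Rdiv_lt_0_compat. }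
  intros h Hh. assert (Hh0 := Cmod_ge_0 h).
  assert (Hh1 : Cmod h < delta) by (eapply Rlt_le_trans; [exact Hh|apply Rmin_l]).
  assert (Hh2 : Cmod h < eps / (Rabs B + 1)) by (eapply Rlt_le_trans; [exact Hh|apply Rmin_r]).
  eapply Rle_trans; [now apply H|].
  apply Rlt_div_r in Hh2; [|easy].
  assert (HBB := Rle_abs B). rewrite <- Rmult_assoc.
  apply Rmult_le_compat_r; [easy|]. nra.
Qed.

Lemma C_minus_R_neq_0 (w : C) (t : R) : 0 < snd w -> (w - RtoC t)%C <> 0.
Proof.
  intros Hw H. apply (f_equal snd) in H. simpl in H. lra.
Qed.

Lemma Cmod_minus_R_ge (w : C) (t : R) : snd w <= Cmod (w - RtoC t)%C.
Proof.
  eapply Rle_trans; [|apply snd_le_Cmod]. simpl.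
  rewrite Ropp_0, Rplus_0_r. apply Rle_abs.
Qed.

Lemma Cmod_inv_minus_R_le (w : C) (t : R) :
  0 < snd w -> Cmod (/ (w - RtoC t))%C <= / snd w.
Proof.
  intros Hw. rewrite Cmod_inv by now apply C_minus_R_neq_0.
  apply Rinv_le_contravar; [easy|]. apply Cmod_minus_R_ge.
Qed.

Lemma Clipschitz_minus (f g : R -> C) :
  Clipschitz f -> Clipschitz g -> Clipschitz (fun t => f t - g t)%C.
Proof.
  intros [L HL] [M HM]. exists (L + M). intros s t.
  replace (f s - g s - (f t - g t))%C with ((f s - f t) + - (g s - g t))%C by ring.
  eapply Rle_trans; [apply Cmod_triangle|]. rewrite Cmod_opp.
  specialize (HL s t). specialize (HM s t). lra.
Qed.

Lemma Clipschitz_scal (c : C) (g : R -> C) :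
  Clipschitz g -> Clipschitz (fun t => c * g t)%C.
Proof.
  intros [L HL]. exists (Cmod c * L). intros s t.
  replace (c * g s - c * g t)%C with (c * (g s - g t))%C by ring.
  rewrite Cmod_mult, Rmult_assoc. apply Rmult_le_compat_l; [apply Cmod_ge_0|apply HL].
Qed.

Lemma Clipschitz_square (B : R) (g : R -> C) :
  (forall t, Cmod (g t) <= B) -> Clipschitz g -> Clipschitz (fun t => g t * g t)%C.
Proof.
  intros HB [L HL]. exists (2 * B * L). intros s t.
  replace (g s * g s - g t * g t)%C with ((g s + g t) * (g s - g t))%C by ring.
  rewrite Cmod_mult, Rmult_assoc. apply Rmult_le_compat; try apply Cmod_ge_0.
  - eapply Rle_trans; [apply Cmod_triangle|].
    generalize (HB s) (HB t). lra.
  - apply HL.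
Qed.

(** By the resolvent identity the difference is [(s - t) / ((w - s) * (w - t))], and each inverse is
    at most [1 / Im w] in modulus. *)
Lemma Clipschitz_inv_minus_R (w : C) :
  0 < snd w -> Clipschitz (fun t => / (w - RtoC t))%C.
Proof.
  intros Hw. exists (/ snd w * / snd w). intros s t.
  assert (Hs := C_minus_R_neq_0 w s Hw). assert (Ht := C_minus_R_neq_0 w t Hw).
  replace (/ (w - RtoC s) - / (w - RtoC t))%C
    with (/ (w - RtoC s) * / (w - RtoC t) * RtoC (s - t))%C.
  2:{ rewrite RtoC_minus. field. now split. }
  rewrite !Cmod_mult, Cmod_R. apply Rmult_le_compat_r; [apply Rabs_pos|].
  apply Rmult_le_compat; try apply Cmod_ge_0; now apply Cmod_inv_minus_R_le.
Qed.

(** At [w = x + iy] the real part of this analytic kernel is [y / ((x - t)^2 + y^2)]; its integral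
    is the analytic completion [u + i v] of the potential. *)
Definition herglotz_kernel (w : C) (t : R) : C := (Ci * / (w - RtoC t))%C.

Definition herglotz (K : R) (p : R -> R) (w : C) : C := cint K p (herglotz_kernel w).

Lemma Clipschitz_herglotz_kernel (w : C) : 0 < snd w -> Clipschitz (herglotz_kernel w).
Proof. intros Hw. now apply Clipschitz_scal, Clipschitz_inv_minus_R. Qed.

(** Differentiation under the integral: the remainder of the kernel is
    [i h^2 / ((w - t)^2 * (w + h - t))]. For [|h| < Im w / 2] the last factor has modulus at least
    [Im w / 2], so the bound is quadratic in [h] uniformly in [t]. *)
Lemma herglotz_derivable (K : R) (p : R -> R) (w : C) :
  bounded_monotone K p -> 0 < snd w ->
  exists l : C, @is_derive C_AbsRing (AbsRing_NormedModule C_AbsRing) (herglotz K p) w l.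
Proof.
  intros Hp Hw.
  pose (dk := fun t : R => (- Ci * (/ (w - RtoC t) * / (w - RtoC t)))%C).
  assert (Hdk : Clipschitz dk).
  { apply (Clipschitz_scal (- Ci)%C (fun t => / (w - RtoC t) * / (w - RtoC t))%C).
    apply (Clipschitz_square (/ snd w)).
    - intros t. now apply Cmod_inv_minus_R_le.
    - now apply Clipschitz_inv_minus_R. }
  exists (cint K p dk).
  apply (is_derive_C_quadratic _ _ _ (4 * K * (/ snd w * / snd w * (2 * / snd w))) (snd w / 2)).
  { lra. }
  intros h Hh.
  assert (Hwh : snd w / 2 < snd (w + h)%C).
  { assert (H := snd_le_Cmod h). apply Rabs_le_between in H. simpl. lra. }
  assert (Hwh0 : 0 < snd (w + h)%C) by lra.
  assert (H1 := Clipschitz_herglotz_kernel w Hw).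
  assert (H2 := Clipschitz_herglotz_kernel _ Hwh0).
  unfold herglotz.
  rewrite <- cint_scal, <- !cint_minus; try assumption.
  2: now apply Clipschitz_minus.
  2: now apply Clipschitz_scal.
  eapply Rle_trans.
  { apply (Cmod_cint_le K (Cmod h * Cmod h * (/ snd w * / snd w * (2 * / snd w)))); try assumption.
    - apply Clipschitz_minus; [now apply Clipschitz_minus|now apply Clipschitz_scal].
    - intros t. assert (Ht := C_minus_R_neq_0 w t Hw).
      assert (Ht' := C_minus_R_neq_0 (w + h)%C t Hwh0).
      unfold dk, herglotz_kernel.
      replace (Ci * / (w + h - RtoC t) - Ci * / (w - RtoC t)
               - h * (- Ci * (/ (w - RtoC t) * / (w - RtoC t))))%C
        with (Ci * (h * h * (/ (w - RtoC t) * / (w - RtoC t) * / (w + h - RtoC t))))%C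
        by (field; now split).
      rewrite !Cmod_mult, Cmod_Ci, Rmult_1_l.
      apply Rmult_le_compat_l.
      { apply Rmult_le_pos; apply Cmod_ge_0. }
      assert (Hi := Cmod_inv_minus_R_le w t Hw).
      apply Rmult_le_compat.
      + apply Rmult_le_pos; apply Cmod_ge_0.
      + apply Cmod_ge_0.
      + apply Rmult_le_compat; try apply Cmod_ge_0; easy.
      + eapply Rle_trans; [now apply Cmod_inv_minus_R_le|].
        replace (2 * / snd w) with (/ (snd w / 2)) by (field; lra).
        apply Rinv_le_contravar; lra. }
  lra.
Qed.

(** * The complex exponential and its derivative *)

Definition Cexp (z : C) : C := (exp (fst z) * cos (snd z), exp (fst z) * sin (snd z)).

Lemma Cmod_Cexp (z : C) : Cmod (Cexp z) = exp (fst z).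
Proof.
  unfold Cmod, Cexp. simpl.
  replace (exp (fst z) * cos (snd z) * (exp (fst z) * cos (snd z) * 1) +
           exp (fst z) * sin (snd z) * (exp (fst z) * sin (snd z) * 1))
    with (Rsqr (exp (fst z)) * (Rsqr (sin (snd z)) + Rsqr (cos (snd z))))
    by (unfold Rsqr; ring).
  rewrite sin2_cos2, Rmult_1_r. apply sqrt_Rsqr, Rlt_le, exp_pos.
Qed.

Lemma Cexp_plus (z h : C) : Cexp (z + h)%C = (Cexp z * Cexp h)%C.
Proof.
  unfold Cexp, Cplus, Cmult. simpl. rewrite exp_plus, cos_plus, sin_plus. f_equal; ring.
Qed.

Lemma derivable_at_0_eps (f : R -> R) (l eps : R) :
  derivable_pt_lim f 0 l -> 0 < eps ->
  exists delta, 0 < delta /\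
    forall x, Rabs x < delta -> Rabs (f x - f 0 - l * x) <= eps * Rabs x.
Proof.
  intros H Heps. destruct (H eps Heps) as [delta Hd].
  exists delta. split; [apply cond_pos|]. intros x Hx.
  destruct (Req_dec x 0) as [->|Hne].
  - replace (f 0 - f 0 - l * 0) with 0 by ring. rewrite Rabs_R0. lra.
  - specialize (Hd x Hne Hx). rewrite Rplus_0_l in Hd.
    replace (f x - f 0 - l * x) with (((f x - f 0) / x - l) * x) by (field; easy).
    rewrite Rabs_mult. apply Rmult_le_compat_r; [apply Rabs_pos|lra].
Qed.

(** The addition formula reduces the claim to the point [0], where the first-order expansions of
    [exp], [cos] and [sin] are combined. *)
Lemma Cexp_derivable (z : C) :
  @is_derive C_AbsRing (AbsRing_NormedModule C_AbsRing) Cexp z (Cexp z).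
Proof.
  apply is_derive_C_eps. intros eps Heps.
  assert (He := exp_pos (fst z)).
  (* The error terms below add up to at most [7 * (e * m)], hence the [8]. The bound [e <= 1] serves
     for [|1 + x| <= 2] and [|sin y| <= 2 * m]. *)
  pose (e := Rmin 1 (eps / (8 * exp (fst z)))).
  assert (He0 : 0 < e).
  { apply Rmin_glb_lt; [lra|]. apply Rdiv_lt_0_compat; lra. }
  assert (He1 : e <= 1) by apply Rmin_l.
  assert (He2 : e * (8 * exp (fst z)) <= eps).
  { apply Rle_div_r; [lra|apply Rmin_r]. }
  destruct (derivable_at_0_eps exp 1 e) as [d1 [Hd1 H1]]; [|easy|].
  { generalize (derivable_pt_lim_exp 0). now rewrite exp_0. }
  destruct (derivable_at_0_eps cos 0 e) as [d2 [Hd2 H2]]; [|easy|].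
  { generalize (derivable_pt_lim_cos 0). now rewrite sin_0, Ropp_0. }
  destruct (derivable_at_0_eps sin 1 e) as [d3 [Hd3 H3]]; [|easy|].
  { generalize (derivable_pt_lim_sin 0). now rewrite cos_0. }
  rewrite exp_0 in H1. rewrite cos_0 in H2. rewrite sin_0 in H3.
  exists (Rmin (Rmin d1 e) (Rmin d2 d3)). split.
  { apply Rmin_glb_lt; apply Rmin_glb_lt; easy. }
  intros h Hh.
  assert (Hx := fst_le_Cmod h). assert (Hy := snd_le_Cmod h).
  assert (Hm1 := Rmin_l (Rmin d1 e) (Rmin d2 d3)).
  assert (Hm2 := Rmin_r (Rmin d1 e) (Rmin d2 d3)).
  assert (Hm3 := Rmin_l d1 e). assert (Hm4 := Rmin_r d1 e).
  assert (Hm5 := Rmin_l d2 d3). assert (Hm6 := Rmin_r d2 d3).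
  destruct h as [x y]. set (m := Cmod (x, y)) in *. simpl in Hx, Hy.
  assert (Hm : 0 <= m) by apply Cmod_ge_0.
  specialize (H1 x). specialize (H2 y). specialize (H3 y).
  assert (G1 : Rabs (exp x - 1 - 1 * x) <= e * m).
  { eapply Rle_trans; [apply H1; lra|]. apply Rmult_le_compat_l; lra. }
  assert (G2 : Rabs (cos y - 1 - 0 * y) <= e * m).
  { eapply Rle_trans; [apply H2; lra|]. apply Rmult_le_compat_l; lra. }
  assert (G3 : Rabs (sin y - 0 - 1 * y) <= e * m).
  { eapply Rle_trans; [apply H3; lra|]. apply Rmult_le_compat_l; lra. }
  replace (Cexp (z + (x, y)) - Cexp z - (x, y) * Cexp z)%C
    with (Cexp z * (Cexp (x, y) - 1 - (x, y)))%C by (rewrite Cexp_plus; ring).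
  rewrite Cmod_mult, Cmod_Cexp.
  apply Rle_trans with (exp (fst z) * (8 * (e * m))).
  2:{ replace (exp (fst z) * (8 * (e * m))) with (e * (8 * exp (fst z)) * m) by ring.
      now apply Rmult_le_compat_r. }
  apply Rmult_le_compat_l; [lra|].
  eapply Rle_trans; [apply Cmod_le_fst_snd|].
  unfold Cexp. simpl.
  replace (exp x * cos y + - (1) + - x)
    with ((exp x - 1 - 1 * x) * cos y + (1 + x) * (cos y - 1 - 0 * y)) by ring.
  replace (exp x * sin y + - 0 + - y)
    with (((exp x - 1 - 1 * x) + x) * sin y + (sin y - 0 - 1 * y)) by ring.
  assert (C1 : Rabs (cos y) <= 1) by (apply Rabs_le; apply COS_bound).
  assert (C2 : Rabs (sin y) <= 1) by (apply Rabs_le; apply SIN_bound).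
  assert (C3 : Rabs (sin y) <= 2 * m).
  { replace (sin y) with ((sin y - 0 - 1 * y) + y) by ring.
    eapply Rle_trans; [apply Rabs_triang|]. nra. }
  assert (Hxe : Rabs x <= e) by lra.
  assert (A1 : Rabs ((exp x - 1 - 1 * x) * cos y) <= e * m * 1).
  { rewrite Rabs_mult. apply Rmult_le_compat; auto using Rabs_pos. }
  assert (A2 : Rabs ((1 + x) * (cos y - 1 - 0 * y)) <= 2 * (e * m)).
  { rewrite Rabs_mult. apply Rmult_le_compat; auto using Rabs_pos.
    eapply Rle_trans; [apply Rabs_triang|]. rewrite Rabs_R1. lra. }
  assert (A3 : Rabs ((exp x - 1 - 1 * x) * sin y) <= e * m * 1).
  { rewrite Rabs_mult. apply Rmult_le_compat; auto using Rabs_pos. }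
  assert (A4 : Rabs (x * sin y) <= e * (2 * m)).
  { rewrite Rabs_mult. apply Rmult_le_compat; auto using Rabs_pos. }
  assert (T1 := Rabs_triang ((exp x - 1 - 1 * x) * cos y) ((1 + x) * (cos y - 1 - 0 * y))).
  assert (T2 := Rabs_triang (((exp x - 1 - 1 * x) + x) * sin y) (sin y - 0 - 1 * y)).
  assert (T3 := Rabs_triang ((exp x - 1 - 1 * x) * sin y) (x * sin y)).
  rewrite <- Rmult_plus_distr_r in T3.
  assert (Hem : 0 <= e * m) by (apply Rmult_le_pos; lra).
  lra.
Qed.

(** * The Poisson integral and its superlevel set *)

(** The Poisson kernel of the upper half-plane without its factor [1 / PI]. *)
Definition poisson (x y : R) : R := y / (x * x + y * y).

Lemma poisson_den_pos (x y : R) : 0 < y -> 0 < x * x + y * y.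
Proof. intros Hy. nra. Qed.

Lemma poisson_pos (x y : R) : 0 < y -> 0 < poisson x y.
Proof. intros Hy. apply Rdiv_lt_0_compat; [easy|now apply poisson_den_pos]. Qed.

Lemma poisson_le_abs (x x' y : R) :
  0 < y -> Rabs x' <= Rabs x -> poisson x y <= poisson x' y.
Proof.
  intros Hy Hx. apply Rsqr_le_abs_1 in Hx. unfold Rsqr in Hx.
  apply Rmult_le_compat_l; [lra|].
  apply Rinv_le_contravar; [now apply poisson_den_pos|lra].
Qed.

(** The difference of the two values is [(y' - y) * (x^2 - y * y')] over a positive denominator.
    Hence the kernel rises in [y] up to [|x|] and falls afterwards. *)
Lemma poisson_le_of_sign (x y y' : R) :
  0 < y -> 0 < y' -> 0 <= (y' - y) * (x * x - y * y') ->
  poisson x y <= poisson x y'.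
Proof.
  intros Hy Hy' H.
  assert (D := poisson_den_pos x y Hy). assert (D' := poisson_den_pos x y' Hy').
  apply Rminus_le_0.
  replace (poisson x y' - poisson x y)
    with ((y' - y) * (x * x - y * y') / ((x * x + y * y) * (x * x + y' * y')))
    by (unfold poisson; field; lra).
  apply Rdiv_le_0_compat; [easy|]. now apply Rmult_lt_0_compat.
Qed.

Lemma poisson_increasing (x y y' : R) :
  0 < y -> y <= y' -> y' <= Rabs x -> poisson x y <= poisson x y'.
Proof.
  intros Hy Hyy Hx. apply poisson_le_of_sign; try lra.
  apply Rmult_le_pos; [lra|].
  rewrite <- (Rabs_pos_eq (x * x)), Rabs_mult by apply Rle_0_sqr. nra.
Qed.

Lemma poisson_decreasing (x y y' : R) :
  0 < y' -> y' <= y -> Rabs x <= y' -> poisson x y <= poisson x y'.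
Proof.
  intros Hy Hyy Hx. apply poisson_le_of_sign; try lra.
  replace ((y' - y) * (x * x - y * y')) with ((y - y') * (y * y' - x * x)) by ring.
  assert (Hx0 := Rabs_pos x). apply Rmult_le_pos; [lra|].
  rewrite <- (Rabs_pos_eq (x * x)), Rabs_mult by apply Rle_0_sqr. nra.
Qed.

Definition potential (K : R) (p : R -> R) (x y : R) : R :=
  RInt (fun s => poisson (x - p s) y) (- K) K.

Lemma fst_herglotz_kernel (x y t : R) :
  0 < y -> fst (herglotz_kernel (x, y) t) = poisson (x - t) y.
Proof.
  intros Hy. assert (D := poisson_den_pos (x - t) y Hy).
  unfold herglotz_kernel, poisson, Cinv, Cmult, Ci, Cminus, Cplus, Copp, RtoC. simpl.
  field. nra.
Qed.

Lemma fst_herglotz (K : R) (p : R -> R) (x y : R) :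
  0 < y -> fst (herglotz K p (x, y)) = potential K p x y.
Proof.
  intros Hy. unfold herglotz, cint, potential. cbn [fst].
  apply RInt_ext. intros s _. now apply fst_herglotz_kernel.
Qed.

Lemma ex_RInt_poisson (K : R) (p : R -> R) (x y a b : R) :
  bounded_monotone K p -> 0 < y -> a <= b ->
  ex_RInt (fun s => poisson (x - p s) y) a b.
Proof.
  intros Hp Hy Hab.
  apply ex_RInt_ext with (fun s => fst (herglotz_kernel (x, y) (p s))).
  { intros s _. now apply fst_herglotz_kernel. }
  eapply ex_RInt_fst; [eassumption| |easy]. now apply Clipschitz_herglotz_kernel.
Qed.

Lemma potential_le (K : R) (p : R -> R) (x y x' y' : R) :
  bounded_monotone K p -> 0 < y -> 0 < y' ->
  (forall s, poisson (x - p s) y <= poisson (x' - p s) y') ->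
  potential K p x y <= potential K p x' y'.
Proof.
  intros Hp Hy Hy' H. assert (HK : - K <= K) by (destruct Hp; lra).
  apply RInt_le; [easy| | |intros s _; apply H]; eapply ex_RInt_poisson; eassumption.
Qed.

Lemma potential_le_const (K : R) (p : R -> R) (x y B : R) :
  bounded_monotone K p -> 0 < y -> (forall s, poisson (x - p s) y <= B) ->
  potential K p x y <= 2 * K * B.
Proof.
  intros Hp Hy H. assert (HK : - K <= K) by (destruct Hp; lra).
  apply Rle_trans with (RInt (fun _ => B) (- K) K).
  - apply RInt_le; [easy| | |intros s _; apply H].
    + eapply ex_RInt_poisson; eassumption.
    + apply ex_RInt_const.
  - rewrite RInt_const. change ((K - - K) * B <= 2 * K * B). lra.
Qed.

Lemma potential_ge0 (K : R) (p : R -> R) (x y : R) :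
  bounded_monotone K p -> 0 < y -> 0 <= potential K p x y.
Proof.
  intros Hp Hy. assert (HK : - K <= K) by (destruct Hp; lra).
  apply RInt_ge_0; [easy|eapply ex_RInt_poisson; eassumption|].
  intros s _. now apply Rlt_le, poisson_pos.
Qed.

(** The worst case is [|x| = 3y], where the kernel equals [y / (10 y^2)]. *)
Lemma poisson_ge_near (x y : R) :
  0 < y -> Rabs x <= 3 * y -> / (10 * y) <= poisson x y.
Proof.
  intros Hy Hx. apply Rle_trans with (poisson (3 * y) y).
  - right. unfold poisson. field. nra.
  - apply poisson_le_abs; [easy|]. rewrite (Rabs_pos_eq (3 * y)); lra.
Qed.

(* An interval of length [y] around [x] is mapped by [p] into [[x - 3y, x + 3y]]. *)
Lemma potential_ge (A : R -> Prop) (K : R) (p : R -> R) (x y : R) :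
  bounded_monotone K p -> nearest_point_map A p ->
  Rabs x <= K -> 0 < y -> y <= 2 * K -> Rabs (x - p x) <= y ->
  1 / 10 <= potential K p x y.
Proof.
  intros Hp HA Hx Hy HyK Hd.
  assert (HK : - K <= K) by (destruct Hp; lra).
  apply Rabs_le_between in Hx.
  (* As [y <= 2K], an interval [[c, c + y]] containing [x] fits inside [[-K, K]]: it starts at [x]
     if there is room, and otherwise ends at [K]. *)
  assert (Hc : exists c, - K <= c /\ c + y <= K /\ x - y <= c <= x).
  { destruct (Rle_dec (x + y) K); [exists x|exists (K - y)]; lra. }
  destruct Hc as [c [Hc1 [Hc2 Hc3]]].
  assert (Hex : forall a b, a <= b -> ex_RInt (fun s => poisson (x - p s) y) a b).
  { intros a b Hab. eapply ex_RInt_poisson; eassumption. }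
  assert (Hpos : forall a b, a <= b -> 0 <= RInt (fun s => poisson (x - p s) y) a b).
  { intros a b Hab. apply RInt_ge_0; auto. intros s _. now apply Rlt_le, poisson_pos. }
  unfold potential.
  rewrite <- (RInt_Chasles (fun s => poisson (x - p s) y) (- K) c K) by (apply Hex; lra).
  rewrite <- (RInt_Chasles (fun s => poisson (x - p s) y) c (c + y) K) by (apply Hex; lra).
  assert (H1 := Hpos (- K) c). assert (H2 := Hpos (c + y) K).
  assert (H3 : 1 / 10 <= RInt (fun s => poisson (x - p s) y) c (c + y)).
  { apply Rle_trans with (RInt (fun _ => / (10 * y)) c (c + y)).
    - rewrite RInt_const. change (1 / 10 <= (c + y - c) * / (10 * y)).
      right. field. lra.
    - apply RInt_le; [lra|apply ex_RInt_const|apply Hex; lra|].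
      intros s Hs. apply poisson_ge_near; [easy|].
      destruct (HA s) as [_ Hns]. destruct (HA x) as [HAx _].
      specialize (Hns _ HAx).
      (* Since [p x] belongs to [A], [|s - p s| <= |s - p x| <= |s - x| + |x - p x| <= 2y], and
         therefore [|x - p s| <= 3y]. *)
      assert (T1 := Rabs_triang (s - x) (x - p x)).
      replace (s - x + (x - p x)) with (s - p x) in T1 by ring.
      assert (T2 := Rabs_triang (x - s) (s - p s)).
      replace (x - s + (s - p s)) with (x - p s) in T2 by ring.
      assert (Hsx : Rabs (s - x) <= y) by (apply Rabs_le; lra).
      rewrite (Rabs_minus_sym x s) in T2. lra. }
  unfold plus. simpl. lra.
Qed.

(** * Connectedness of the superlevel set *)

Definition rel_open (A U : C -> Prop) : Prop :=
  forall z, A z -> U z -> exists delta, 0 < delta /\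
    forall z', A z' -> Cmod (z' - z)%C < delta -> U z'.

(** Let [m] be the supremum of the parameters whose points lie in [U]. If [g m] is in [U] and
    [m < 1], relative openness pushes [U] beyond [m]; if [g m] is in [V], then [V] also holds just
    before [m], against disjointness. *)
Lemma segment_one_side (A U V : C -> Prop) (x y x' y' : R) :
  rel_open A U -> rel_open A V ->
  (forall z, A z -> U z \/ V z) -> (forall z, A z -> U z -> V z -> False) ->
  (forall tau, 0 <= tau <= 1 -> A (x + tau * (x' - x), y + tau * (y' - y))) ->
  U (x, y) -> U (x', y').
Proof.
  intros HU HV Hcov Hdis HA HUp.
  set (g := fun tau => (x + tau * (x' - x), y + tau * (y' - y)) : C).
  assert (Hg0 : g 0 = (x, y)) by (unfold g; f_equal; ring).
  assert (Hg1 : g 1 = (x', y')) by (unfold g; f_equal; ring).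
  set (N := Rabs (x' - x) + Rabs (y' - y) + 1).
  assert (HN : 0 < N).
  { unfold N. generalize (Rabs_pos (x' - x)) (Rabs_pos (y' - y)). lra. }
  assert (Hlip : forall s t d, Rabs (s - t) < d / N -> Cmod (g s - g t)%C < d).
  { intros s t d Hst. apply Rlt_div_r in Hst; [|easy].
    eapply Rle_lt_trans; [apply Cmod_le_fst_snd|]. unfold g. simpl.
    replace (x + s * (x' - x) + - (x + t * (x' - x))) with ((s - t) * (x' - x)) by ring.
    replace (y + s * (y' - y) + - (y + t * (y' - y))) with ((s - t) * (y' - y)) by ring.
    rewrite !Rabs_mult. unfold N in Hst. generalize (Rabs_pos (s - t)). lra. }
  rewrite <- Hg1. rewrite <- Hg0 in HUp. apply NNPP. intros HnU.
  destruct (completeness (fun t => 0 <= t <= 1 /\ U (g t))) as [m [Hm1 Hm2]].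
  { exists 1. intros t [Ht _]. lra. }
  { exists 0. split; [lra|easy]. }
  assert (H0m : 0 <= m) by (apply Hm1; split; [lra|easy]).
  assert (Hm1' : m <= 1) by (apply Hm2; intros t [Ht _]; lra).
  destruct (Hcov (g m)) as [HUm|HVm]; [apply HA; lra| |].
  - destruct (HU (g m)) as [d [Hd HUd]]; [apply HA; lra|easy|].
    assert (Hmne : m <> 1) by (intros ->; easy).
    assert (HdN : 0 < d / N) by now apply Rdiv_lt_0_compat.
    pose (t := Rmin 1 (m + d / N / 2)).
    assert (Hmt : m < t) by (apply Rmin_glb_lt; lra).
    assert (Ht1 : t <= 1) by apply Rmin_l.
    assert (Ht2 : t <= m + d / N / 2) by apply Rmin_r.
    assert (t <= m); [|lra].
    apply Hm1. split; [lra|]. apply HUd; [apply HA; lra|].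
    apply Hlip. apply Rabs_def1; lra.
  - destruct (HV (g m)) as [d [Hd HVd]]; [apply HA; lra|easy|].
    assert (HdN : 0 < d / N) by now apply Rdiv_lt_0_compat.
    assert (m <= m - d / N / 2); [|lra].
    apply Hm2. intros t [Ht HUt]. apply Rnot_lt_le. intros Hlt.
    assert (Htm : t <= m) by (apply Hm1; easy).
    apply (Hdis (g t)); [now apply HA|easy|].
    apply HVd; [now apply HA|]. apply Hlip. apply Rabs_def1; lra.
Qed.

Definition superlevel (K : R) (p : R -> R) (w : C) : Prop :=
  0 < snd w /\ 1 / 20 < potential K p (fst w) (snd w).

(* Path to [(0, 2K)]: horizontally into [[-K, K]], vertically to height [2K], then along it. *)
Lemma superlevel_one_side (A : R -> Prop) (K : R) (p : R -> R) (U V : C -> Prop) (w : C) :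
  bounded_monotone K p -> nearest_point_map A p ->
  rel_open (superlevel K p) U -> rel_open (superlevel K p) V ->
  (forall z, superlevel K p z -> U z \/ V z) ->
  (forall z, superlevel K p z -> U z -> V z -> False) ->
  superlevel K p w -> U w -> U (0, 2 * K).
Proof.
  intros Hp HA HU HV Hcov Hdis Hw HUw.
  assert (HK : 0 < K) by now destruct Hp.
  assert (Hb : forall s, - K <= p s <= K).
  { intros s. apply Rabs_le_between. now apply Hp. }
  destruct w as [x y]. destruct Hw as [Hy Hw]. simpl in Hy, Hw.
  (* [x1] is [x] clamped to [[-K, K]]. *)
  pose (x1 := Rmax (- K) (Rmin x K)).
  assert (Hx1 : - K <= x1 <= K).
  { split; [apply Rmax_l|]. apply Rmax_lub; [lra|apply Rmin_r]. }
  (* Every [p s] lies in [[-K, K]], so moving towards the clamped point brings the abscissa no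
     farther from any of them and the potential does not drop. *)
  assert (Hclose : forall tau s, 0 <= tau <= 1 ->
    Rabs (x + tau * (x1 - x) - p s) <= Rabs (x - p s)).
  { intros tau s Htau. specialize (Hb s). set (z := x + tau * (x1 - x)).
    destruct (Rle_dec x K) as [HxK|HxK]; [destruct (Rle_dec (- K) x) as [HKx|HKx]|].
    - assert (Hz : z = x).
      { unfold z, x1. rewrite Rmin_left, Rmax_right by lra. ring. }
      rewrite Hz. lra.
    - assert (Hz : x <= z <= - K).
      { unfold z, x1. rewrite Rmin_left, Rmax_left by lra. nra. }
      rewrite !Rabs_left1; lra.
    - assert (Hz : K <= z <= x).
      { unfold z, x1. rewrite Rmin_right, Rmax_right by lra. nra. }
      rewrite !Rabs_pos_eq; lra. }
  assert (H1 : forall tau, 0 <= tau <= 1 -> superlevel K p (x + tau * (x1 - x), y)).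
  { intros tau Htau. split; simpl; [easy|].
    eapply Rlt_le_trans; [exact Hw|]. apply potential_le; try easy.
    intros s. apply poisson_le_abs; auto. }
  assert (U1 : U (x1, y)).
  { apply (segment_one_side (superlevel K p) U V x y); try easy.
    intros tau Htau. replace (y + tau * (y - y)) with y by ring. auto. }
  assert (Hw1 : 1 / 20 < potential K p x1 y).
  { destruct (H1 1) as [_ H]; [lra|]. simpl in H.
    now replace (x + 1 * (x1 - x)) with x1 in H by ring. }
  assert (Hx1' : Rabs x1 <= K) by (now apply Rabs_le).
  assert (Hfar : forall z s, - K <= z <= K -> Rabs (z - p s) <= 2 * K).
  { intros z s Hz. specialize (Hb s). apply Rabs_le. lra. }
  assert (H2 : forall tau, 0 <= tau <= 1 -> superlevel K p (x1, y + tau * (2 * K - y))).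
  { intros tau Htau. set (y2 := y + tau * (2 * K - y)).
    assert (Hy2 : 0 < y2) by (unfold y2; nra).
    split; simpl; [easy|].
    (* Above height [2K] the path goes down, and every [|x1 - p s|] is at most [2K], in the range
       where the kernel gains by descending. *)
    destruct (Rle_dec (2 * K) y) as [Hy2K|Hy2K].
    - assert (H2K : 2 * K <= y2 <= y) by (unfold y2; nra).
      eapply Rlt_le_trans; [exact Hw1|]. apply potential_le; try easy.
      intros s. apply poisson_decreasing; try lra.
      specialize (Hfar x1 s Hx1). lra.
    - assert (H2K : y <= y2 <= 2 * K) by (unfold y2; nra).
      (* Once the height reaches the distance from [x1] to [A], the bound [1/10] takes over. Below
         it, every [|x1 - p s|] exceeds the height, so the kernel still increases along the way
         up. *)
      destruct (Rle_dec (Rabs (x1 - p x1)) y2) as [Hd|Hd].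
      + apply Rlt_le_trans with (1 / 10); [lra|].
        apply (potential_ge A); try easy.
      + eapply Rlt_le_trans; [exact Hw1|]. apply potential_le; try easy.
        intros s. apply poisson_increasing; try lra.
        destruct (HA x1) as [_ Hn]. destruct (HA s) as [Hs _].
        specialize (Hn _ Hs). lra. }
  assert (U2 : U (x1, 2 * K)).
  { apply (segment_one_side (superlevel K p) U V x1 y); try easy.
    intros tau Htau. replace (x1 + tau * (x1 - x1)) with x1 by ring. auto. }
  apply (segment_one_side (superlevel K p) U V x1 (2 * K)); try easy.
  intros tau Htau. replace (2 * K + tau * (2 * K - 2 * K)) with (2 * K) by ring.
  (* Along the segment at height [2K] the distance to [A] is at most [2K], so the bound [1/10] holds
     throughout. *)
  set (z := x1 + tau * (0 - x1)).
  assert (Hz : - K <= z <= K) by (unfold z; nra).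
  split; simpl; [lra|]. apply Rlt_le_trans with (1 / 10); [lra|].
  apply (potential_ge A); try easy; try lra.
  - now apply Rabs_le.
  - now apply Hfar.
Qed.

(** * Transfer to the disc *)

(** The Cayley transform of the disc onto the upper half-plane that sends [a] to infinity and [0] to
    [i]; [to_disc] is its inverse. *)
Definition to_plane (a z : C) : C := (Ci * (a + z) / (a - z))%C.
Definition to_disc (a w : C) : C := (a * (w - Ci) / (w + Ci))%C.

Lemma Cmod_sqr (z : C) : Cmod z * Cmod z = fst z * fst z + snd z * snd z.
Proof.
  unfold Cmod. rewrite sqrt_sqrt; simpl; nra.
Qed.

Lemma Cmod_plus_Ci_ge1 (w : C) : 0 <= snd w -> 1 <= Cmod (w + Ci)%C.
Proof.
  intros Hw. eapply Rle_trans; [|apply snd_le_Cmod]. simpl.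
  rewrite Rabs_pos_eq; lra.
Qed.

Lemma plus_Ci_neq_0 (w : C) : 0 <= snd w -> (w + Ci)%C <> 0.
Proof.
  intros Hw. apply Cmod_gt_0. generalize (Cmod_plus_Ci_ge1 w Hw). lra.
Qed.

Lemma C2_Ci_neq_0 : (2 * Ci)%C <> 0.
Proof. intros H. apply (f_equal snd) in H. simpl in H. lra. Qed.

Lemma unit_neq_0 (a : C) : Cmod a = 1 -> a <> 0.
Proof. intros Ha. apply Cmod_gt_0. lra. Qed.

Lemma minus_neq_0 (a z : C) : z <> a -> (a - z)%C <> 0.
Proof.
  intros Hz H. apply Hz. replace z with (a - (a - z))%C by ring. rewrite H. ring.
Qed.

Lemma to_plane_plus_Ci (a z : C) :
  z <> a -> (to_plane a z + Ci = 2 * Ci * a / (a - z))%C.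
Proof.
  intros Hz. assert (Hn := minus_neq_0 a z Hz).
  unfold to_plane. field. easy.
Qed.

Lemma to_plane_plus_Ci_neq_0 (a z : C) :
  Cmod a = 1 -> z <> a -> (to_plane a z + Ci)%C <> 0.
Proof.
  intros Ha Hz. rewrite to_plane_plus_Ci by easy.
  assert (Hn := minus_neq_0 a z Hz).
  apply Cmult_neq_0.
  - apply Cmult_neq_0; [apply C2_Ci_neq_0|now apply unit_neq_0].
  - intros H. apply (f_equal (Cmult (a - z)%C)) in H.
    rewrite Cinv_r, Cmult_0_r in H by easy. apply C1_nz. exact H.
Qed.

Lemma to_disc_to_plane (a z : C) :
  Cmod a = 1 -> z <> a -> to_disc a (to_plane a z) = z.
Proof.
  intros Ha Hz. assert (Hn := minus_neq_0 a z Hz).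
  assert (Ha0 := unit_neq_0 a Ha). assert (H2 := C2_Ci_neq_0).
  assert (Hi : Ci <> 0). { intros H. apply H2. rewrite H. ring. }
  unfold to_disc. rewrite to_plane_plus_Ci by easy.
  unfold to_plane. field. repeat split; try easy.
Qed.

Lemma to_plane_to_disc (a w : C) :
  Cmod a = 1 -> 0 <= snd w -> to_plane a (to_disc a w) = w.
Proof.
  intros Ha Hw. assert (Hn := plus_Ci_neq_0 w Hw).
  assert (Ha0 := unit_neq_0 a Ha). assert (H2 := C2_Ci_neq_0).
  assert (Hi : Ci <> 0). { intros H. apply H2. rewrite H. ring. }
  unfold to_plane, to_disc.
  replace (a - a * (w - Ci) / (w + Ci))%C with (a * (2 * Ci) / (w + Ci))%C by (field; easy).
  field. repeat split; easy.
Qed.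

(** This is [|w + i|^2 - |w - i|^2 = 4 Im w]. It matches the disc with the upper half-plane and the
    circle with the real line. *)
Lemma one_minus_Cmod_to_disc (a w : C) :
  Cmod a = 1 -> (w + Ci)%C <> 0 ->
  (1 - Cmod (to_disc a w) * Cmod (to_disc a w)) * (Cmod (w + Ci)%C * Cmod (w + Ci)%C)
  = 4 * snd w.
Proof.
  intros Ha Hw. unfold to_disc. rewrite Cmod_div, Cmod_mult, Ha by easy.
  assert (H0 : Cmod (w + Ci)%C <> 0).
  { apply Cmod_gt_0 in Hw. lra. }
  replace ((1 - 1 * Cmod (w - Ci)%C / Cmod (w + Ci)%C * (1 * Cmod (w - Ci)%C / Cmod (w + Ci)%C)) *
    (Cmod (w + Ci)%C * Cmod (w + Ci)%C))
    with (Cmod (w + Ci)%C * Cmod (w + Ci)%C - Cmod (w - Ci)%C * Cmod (w - Ci)%C)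
    by (field; easy).
  rewrite !Cmod_sqr. simpl. ring.
Qed.

Lemma in_disc_neq_unit (a z : C) : Cmod a = 1 -> in_disc z -> z <> a.
Proof. unfold in_disc. intros Ha Hz ->. lra. Qed.

Lemma snd_to_plane_pos (a z : C) : Cmod a = 1 -> in_disc z -> 0 < snd (to_plane a z).
Proof.
  intros Ha Hz. assert (Hne := in_disc_neq_unit a z Ha Hz).
  assert (Hn := to_plane_plus_Ci_neq_0 a z Ha Hne).
  assert (H := one_minus_Cmod_to_disc a (to_plane a z) Ha Hn).
  rewrite to_disc_to_plane in H by easy.
  apply Cmod_gt_0 in Hn. unfold in_disc in Hz. assert (H0 := Cmod_ge_0 z).
  assert (0 < Cmod (to_plane a z + Ci)%C * Cmod (to_plane a z + Ci)%C)
    by now apply Rmult_lt_0_compat.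
  assert (0 < 1 - Cmod z * Cmod z) by nra.
  assert (0 < (1 - Cmod z * Cmod z) * (Cmod (to_plane a z + Ci)%C * Cmod (to_plane a z + Ci)%C))
    by now apply Rmult_lt_0_compat.
  lra.
Qed.

Lemma to_disc_in_disc (a w : C) : Cmod a = 1 -> 0 < snd w -> in_disc (to_disc a w).
Proof.
  intros Ha Hw. assert (Hn := plus_Ci_neq_0 w (Rlt_le _ _ Hw)).
  assert (H := one_minus_Cmod_to_disc a w Ha Hn).
  apply Cmod_gt_0 in Hn. unfold in_disc. apply Rnot_le_lt. intros Hge.
  set (m := Cmod (to_disc a w)) in *. set (n := Cmod (w + Ci)%C) in *.
  assert (0 < n * n) by now apply Rmult_lt_0_compat.
  assert (1 - m * m <= 0) by nra. nra.
Qed.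

Lemma unit_circle_to_disc (a z : C) :
  Cmod a = 1 -> Cmod z = 1 -> z <> a -> exists t : R, z = to_disc a (RtoC t).
Proof.
  intros Ha Hz Hne. exists (fst (to_plane a z)).
  assert (Hn := to_plane_plus_Ci_neq_0 a z Ha Hne).
  assert (H := one_minus_Cmod_to_disc a (to_plane a z) Ha Hn).
  rewrite to_disc_to_plane, Hz in H by easy.
  assert (Hs : snd (to_plane a z) = 0) by lra.
  replace (RtoC (fst (to_plane a z))) with (to_plane a z).
  - symmetry. now apply to_disc_to_plane.
  - unfold RtoC. rewrite <- Hs. apply surjective_pairing.
Qed.

(** The difference of the images is [2 i a (w - w') / ((w + i) * (w' + i))]. *)
Lemma Cmod_to_disc_minus (a w w' : C) :
  Cmod a = 1 -> 0 <= snd w -> 0 <= snd w' ->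
  Cmod (to_disc a w - to_disc a w')%C * (Cmod (w + Ci)%C * Cmod (w' + Ci)%C)
  = 2 * Cmod (w - w')%C.
Proof.
  intros Ha Hw Hw'. assert (Hn := plus_Ci_neq_0 w Hw). assert (Hn' := plus_Ci_neq_0 w' Hw').
  rewrite <- !Cmod_mult.
  replace ((to_disc a w - to_disc a w') * ((w + Ci) * (w' + Ci)))%C
    with (a * (RtoC 2 * (Ci * (w - w'))))%C by (unfold to_disc; field; now split).
  rewrite !Cmod_mult, Ha, Cmod_Ci, Cmod_R, Rabs_pos_eq; lra.
Qed.

Lemma Cmod_to_disc_minus_le (a w w' : C) :
  Cmod a = 1 -> 0 <= snd w -> 0 <= snd w' ->
  Cmod (to_disc a w - to_disc a w')%C <= 2 * Cmod (w - w')%C.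
Proof.
  intros Ha Hw Hw'. rewrite <- (Cmod_to_disc_minus a w w') by easy.
  assert (H1 := Cmod_plus_Ci_ge1 w Hw). assert (H2 := Cmod_plus_Ci_ge1 w' Hw').
  rewrite <- (Rmult_1_r (Cmod (to_disc a w - to_disc a w')%C)) at 1.
  apply Rmult_le_compat_l; [apply Cmod_ge_0|]. nra.
Qed.

Lemma to_plane_derivable (a z : C) :
  Cmod a = 1 -> in_disc z ->
  exists l : C, @is_derive C_AbsRing (AbsRing_NormedModule C_AbsRing) (to_plane a) z l.
Proof.
  intros Ha Hz. unfold in_disc in Hz. set (r := 1 - Cmod z).
  assert (Hr : 0 < r) by (unfold r; lra).
  assert (Hge : forall v, Cmod v < 1 -> 1 - Cmod v <= Cmod (a - v)%C).
  { intros v Hv. assert (H := Cmod_triangle (a - v)%C v).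
    replace (a - v + v)%C with a in H by ring. lra. }
  assert (Hne : forall v, Cmod v < 1 -> (a - v)%C <> 0).
  { intros v Hv. apply Cmod_gt_0. specialize (Hge v Hv). lra. }
  exists (2 * Ci * a / ((a - z) * (a - z)))%C.
  apply (is_derive_C_quadratic _ _ _ (2 * (/ r * / r * / (r / 2))) (r / 2)); [lra|].
  intros h Hh.
  assert (Hzh : Cmod (z + h)%C <= 1 - r / 2).
  { eapply Rle_trans; [apply Cmod_triangle|]. unfold r in *. lra. }
  assert (N1 := Hne z Hz). assert (N2 : (a - (z + h))%C <> 0) by (apply Hne; lra).
  assert (I1 : Cmod (/ (a - z))%C <= / r).
  { rewrite Cmod_inv by easy. apply Rinv_le_contravar; [easy|]. now apply Hge. }
  assert (I2 : Cmod (/ (a - (z + h)))%C <= / (r / 2)).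
  { rewrite Cmod_inv by easy. apply Rinv_le_contravar; [lra|].
    eapply Rle_trans; [|apply Hge; lra]. lra. }
  replace (to_plane a (z + h) - to_plane a z - h * (2 * Ci * a / ((a - z) * (a - z))))%C
    with (RtoC 2 * (Ci * (a * (/ (a - z) * / (a - z) * / (a - (z + h))))) * (h * h))%C
    by (unfold to_plane; field; now split).
  rewrite !Cmod_mult, Cmod_R, Cmod_Ci, Ha, !Rmult_1_l, (Rabs_pos_eq 2) by lra.
  apply Rmult_le_compat_r; [apply Rmult_le_pos; apply Cmod_ge_0|].
  apply Rmult_le_compat_l; [lra|].
  apply Rmult_le_compat; [apply Rmult_le_pos; apply Cmod_ge_0|apply Cmod_ge_0| |easy].
  apply Rmult_le_compat; try apply Cmod_ge_0; easy.
Qed.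

(** The chain rule is applied over [AbsRing_NormedModule C_AbsRing], whereas [holomorphic_on_disc]
    uses [C_NormedModule]; both carry the norm [Cmod], so the remainder condition is the same. *)
Lemma is_derive_C_NormedModule (f : C -> C) (z l : C) :
  @is_derive C_AbsRing (AbsRing_NormedModule C_AbsRing) f z l ->
  @is_derive C_AbsRing C_NormedModule f z l.
Proof.
  intros [_ H]. split; [apply is_linear_scal_l|].
  intros x Hx eps. exact (H x Hx eps).
Qed.

(** * The function on the disc: analyticity, modulus, boundary behaviour and sublevel set *)

Definition one_component_function (a : C) (K : R) (p : R -> R) (z : C) : C :=
  Cexp (- herglotz K p (to_plane a z))%C.

Lemma one_component_function_holomorphic (a : C) (K : R) (p : R -> R) :
  Cmod a = 1 -> bounded_monotone K p ->
  holomorphic_on_disc (one_component_function a K p).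
Proof.
  intros Ha Hp z Hz. assert (Hpos := snd_to_plane_pos a z Ha Hz).
  destruct (to_plane_derivable a z Ha Hz) as [l1 H1].
  destruct (herglotz_derivable K p _ Hp Hpos) as [l2 H2].
  assert (H3 := is_derive_comp _ _ _ _ _ H2 H1).
  apply is_derive_opp in H3.
  assert (H4 := is_derive_comp _ _ _ _ _ (Cexp_derivable _) H3).
  eexists. apply is_derive_C_NormedModule. exact H4.
Qed.

Lemma Cmod_one_component_function (a : C) (K : R) (p : R -> R) (z : C) :
  Cmod a = 1 -> in_disc z ->
  Cmod (one_component_function a K p z)
  = exp (- potential K p (fst (to_plane a z)) (snd (to_plane a z))).
Proof.
  intros Ha Hz. assert (Hpos := snd_to_plane_pos a z Ha Hz).
  unfold one_component_function. rewrite Cmod_Cexp. f_equal.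
  rewrite <- fst_herglotz by easy. now rewrite <- surjective_pairing.
Qed.

(** With [z] and [zeta] the images of [w] and [t], the kernel equals
    [(1 - |z|^2) / (|z - zeta|^2 * |t + i|^2)], and [|t + i| >= 1]. *)
Lemma poisson_to_disc_le (a w : C) (t delta : R) :
  Cmod a = 1 -> 0 < snd w -> 0 < delta ->
  delta <= Cmod (to_disc a w - to_disc a (RtoC t))%C ->
  poisson (fst w - t) (snd w)
  <= (1 - Cmod (to_disc a w) * Cmod (to_disc a w)) / (delta * delta).
Proof.
  intros Ha Hw Hd Hdist.
  assert (Hw' := Rlt_le _ _ Hw).
  assert (Ht : 0 <= snd (RtoC t)) by (simpl; lra).
  assert (H1 := one_minus_Cmod_to_disc a w Ha (plus_Ci_neq_0 w Hw')).
  assert (H2 := Cmod_to_disc_minus a w (RtoC t) Ha Hw' Ht).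
  assert (H3 := Cmod_plus_Ci_ge1 w Hw'). assert (H4 := Cmod_plus_Ci_ge1 _ Ht).
  assert (H5 : (fst w - t) * (fst w - t) + snd w * snd w
               = Cmod (w - RtoC t)%C * Cmod (w - RtoC t)%C).
  { rewrite Cmod_sqr. simpl. ring. }
  unfold poisson. rewrite H5.
  set (m := Cmod (to_disc a w)) in *. set (n := Cmod (w + Ci)%C) in *.
  set (k := Cmod (RtoC t + Ci)%C) in *. set (q := Cmod (w - RtoC t)%C) in *.
  set (e := Cmod (to_disc a w - to_disc a (RtoC t))%C) in *.
  assert (Hq : delta * n / 2 <= q).
  { assert (delta * n <= e * (n * k)); [|lra].
    apply Rmult_le_compat; try lra. nra. }
  assert (Hdn : 0 < delta * n / 2) by (apply Rmult_lt_0_compat; [nra|lra]).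
  apply Rle_trans with (snd w / (delta * n / 2 * (delta * n / 2))).
  - apply Rmult_le_compat_l; [lra|]. apply Rinv_le_contravar; nra.
  - right. replace (snd w) with ((1 - m * m) * (n * n) / 4) by lra. field. lra.
Qed.

(* [|b|] tends to 1 at a boundary point that is away from the image of [p]. *)
Lemma one_component_function_near_1 (a xi z : C) (K delta : R) (p : R -> R) :
  Cmod a = 1 -> bounded_monotone K p -> Cmod xi = 1 -> 0 < delta ->
  (forall s, 2 * delta <= Cmod (to_disc a (RtoC (p s)) - xi)%C) ->
  in_disc z -> Cmod (z - xi)%C < delta ->
  1 - 4 * K / (delta * delta) * Cmod (z - xi)%C <= Cmod (one_component_function a K p z).
Proof.
  intros Ha Hp Hxi Hd Hfar Hz Hzxi.
  rewrite Cmod_one_component_function by easy.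
  assert (Hpos := snd_to_plane_pos a z Ha Hz).
  assert (Hw := to_disc_to_plane a z Ha (in_disc_neq_unit a z Ha Hz)).
  set (w := to_plane a z) in *.
  assert (HK : 0 < K) by now destruct Hp.
  assert (Hdd : 0 < delta * delta) by now apply Rmult_lt_0_compat.
  (* Factor [1 - |z|^2] as [(1 - |z|) * (1 + |z|)]; the first factor is at most [|z - xi|] because
     [|xi| = 1], the second at most [2]. *)
  assert (Hm : 1 - Cmod z * Cmod z <= 2 * Cmod (z - xi)%C).
  { assert (H := Cmod_triangle z (- (z - xi))%C).
    replace (z + - (z - xi))%C with xi in H by ring. rewrite Cmod_opp, Hxi in H.
    unfold in_disc in Hz. assert (H0 := Cmod_ge_0 z). assert (H0' := Cmod_ge_0 (z - xi)%C). nra. }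
  assert (Hu : potential K p (fst w) (snd w)
               <= 2 * K * (2 * Cmod (z - xi)%C / (delta * delta))).
  { apply potential_le_const; try easy. intros s.
    eapply Rle_trans.
    - apply (poisson_to_disc_le a w (p s) delta); try easy.
      rewrite Hw. assert (H := Cmod_triangle (to_disc a (RtoC (p s)) - z)%C (z - xi)%C).
      replace (to_disc a (RtoC (p s)) - z + (z - xi))%C
        with (to_disc a (RtoC (p s)) - xi)%C in H by ring.
      specialize (Hfar s).
      replace (z - to_disc a (RtoC (p s)))%C with (- (to_disc a (RtoC (p s)) - z))%C by ring.
      rewrite Cmod_opp. lra.
    - rewrite Hw. apply Rmult_le_compat_r; [|easy].
      now apply Rlt_le, Rinv_0_lt_compat. }
  assert (He := exp_ineq1_le (- potential K p (fst w) (snd w))).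
  unfold Rdiv in *. lra.
Qed.

Lemma exp_lt_iff (x y : R) : exp x < exp y <-> x < y.
Proof. split; [apply exp_lt_inv|apply exp_increasing]. Qed.

Lemma sublevel_iff_superlevel (a : C) (K : R) (p : R -> R) (z : C) :
  Cmod a = 1 -> in_disc z ->
  (Cmod (one_component_function a K p z) < exp (- (1 / 20)) <-> superlevel K p (to_plane a z)).
Proof.
  intros Ha Hz. rewrite Cmod_one_component_function, exp_lt_iff by easy.
  assert (Hpos := snd_to_plane_pos a z Ha Hz). unfold superlevel. split; lra.
Qed.

Lemma locally_C_ball (U : C -> Prop) (z : C) :
  locally (T := C_UniformSpace) z U ->
  exists delta, 0 < delta /\ forall z', Cmod (z' - z)%C < delta -> U z'.
Proof.
  intros [d Hd]. exists d. split; [apply cond_pos|].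
  intros z' Hz'. apply Hd. now apply C_NormedModule_mixin_compat1.
Qed.

(** Openness is taken relative to the superlevel set because [to_disc] has a pole at [-i]; on the
    closed upper half-plane it is 2-Lipschitz. *)
Lemma rel_open_preimage (a : C) (K : R) (p : R -> R) (U : C -> Prop) :
  Cmod a = 1 -> open (T := C_UniformSpace) U ->
  rel_open (superlevel K p) (fun w => U (to_disc a w)).
Proof.
  intros Ha HU w [Hw _] HUw.
  destruct (locally_C_ball U _ (HU _ HUw)) as [d [Hd Hball]].
  exists (d / 2). split; [lra|]. intros w' [Hw' _] Hlt.
  apply Hball. eapply Rle_lt_trans.
  - apply Cmod_to_disc_minus_le; [easy|lra|lra].
  - lra.
Qed.

(** A separation of the sublevel set pulls back to the superlevel set, and each of its two sides
    would then contain the hub [(0, 2 * K)]. *)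
Lemma sublevel_connected (A : R -> Prop) (a : C) (K : R) (p : R -> R) :
  Cmod a = 1 -> bounded_monotone K p -> nearest_point_map A p ->
  connected_set (fun z => in_disc z /\
    Cmod (one_component_function a K p z) < exp (- (1 / 20))).
Proof.
  intros Ha Hp HA [U [V [HU [HV [Hcov [[z1 [[Hz1 Hb1] Hz1U]] [[z2 [[Hz2 Hb2] Hz2V]] Hdis]]]]]]].
  assert (HK : 0 < K) by now destruct Hp.
  assert (HS : forall w, superlevel K p w -> in_disc (to_disc a w) /\
    Cmod (one_component_function a K p (to_disc a w)) < exp (- (1 / 20))).
  { intros w Hw. assert (Hd : in_disc (to_disc a w)) by (apply to_disc_in_disc; [easy|apply Hw]).
    split; [easy|]. apply sublevel_iff_superlevel; try easy.
    rewrite to_plane_to_disc; try easy. now apply Rlt_le, Hw. }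
  set (U' := fun w => U (to_disc a w)). set (V' := fun w => V (to_disc a w)).
  assert (OU : rel_open (superlevel K p) U') by now apply rel_open_preimage.
  assert (OV : rel_open (superlevel K p) V') by now apply rel_open_preimage.
  assert (Hcov' : forall w, superlevel K p w -> U' w \/ V' w).
  { intros w Hw. apply Hcov, HS, Hw. }
  assert (Hdis' : forall w, superlevel K p w -> U' w -> V' w -> False).
  { intros w Hw. apply Hdis, HS, Hw. }
  apply sublevel_iff_superlevel in Hb1, Hb2; try easy.
  assert (U0 : U' (0, 2 * K)).
  { apply (superlevel_one_side A K p U' V' (to_plane a z1)); try easy.
    unfold U'. rewrite to_disc_to_plane; [easy..|now apply in_disc_neq_unit]. }
  assert (V0 : V' (0, 2 * K)).
  { apply (superlevel_one_side A K p V' U' (to_plane a z2)); try easy.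
    - intros w Hw. destruct (Hcov' w Hw); [now right|now left].
    - intros w Hw H1 H2. now apply (Hdis' w).
    - unfold V'. rewrite to_disc_to_plane; [easy..|now apply in_disc_neq_unit]. }
  apply (Hdis' (0, 2 * K)); try easy.
  split; simpl; [lra|]. apply Rlt_le_trans with (1 / 10); [lra|].
  destruct Hp as [_ [Hmono Hbound]]. assert (Hb0 := Hbound 0).
  apply (potential_ge A); try easy; try lra.
  - rewrite Rabs_R0. lra.
  - rewrite Rminus_0_l, Rabs_Ropp. lra.
Qed.

Lemma one_component_function_le_1 (a : C) (K : R) (p : R -> R) (z : C) :
  Cmod a = 1 -> bounded_monotone K p -> in_disc z ->
  Cmod (one_component_function a K p z) <= 1.
Proof.
  intros Ha Hp Hz. rewrite Cmod_one_component_function by easy.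
  assert (H := potential_ge0 K p (fst (to_plane a z)) _ Hp (snd_to_plane_pos a z Ha Hz)).
  rewrite <- exp_0. destruct H as [H|H]; [apply Rlt_le, exp_increasing; lra|].
  rewrite <- H, Ropp_0. lra.
Qed.

Lemma closed_C_avoid (E : C -> Prop) (z : C) :
  closed (T := C_UniformSpace) E -> ~ E z ->
  exists delta, 0 < delta /\ forall e, E e -> delta <= Cmod (e - z)%C.
Proof.
  intros HE Hz.
  destruct (locally_C_ball (fun e => ~ E e) z) as [d [Hd Hball]].
  { apply NNPP. intros Hn. now apply Hz, HE. }
  exists d. split; [easy|]. intros e He. apply Rnot_lt_le. intros Hlt. now apply (Hball e).
Qed.

Lemma one_component_function_away (E : C -> Prop) (a xi : C) (K : R) (p : R -> R) (eps : R) :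
  Cmod a = 1 -> bounded_monotone K p -> closed (T := C_UniformSpace) E ->
  (forall s, E (to_disc a (RtoC (p s)))) -> Cmod xi = 1 -> ~ E xi -> 0 < eps ->
  exists delta, 0 < delta /\ forall z, in_disc z -> Cmod (z - xi)%C < delta ->
    1 - eps < Cmod (one_component_function a K p z).
Proof.
  intros Ha Hp HE HpE Hxi HnE Heps.
  destruct (closed_C_avoid E xi HE HnE) as [d [Hd Havoid]].
  assert (HK : 0 < K) by now destruct Hp.
  (* The rate at which [|b|] may fall below [1] near [xi], with half the distance [d] as safety
     margin. *)
  set (c := 4 * K / (d / 2 * (d / 2))).
  assert (Hc : 0 < c).
  { unfold c. apply Rdiv_lt_0_compat; [lra|]. apply Rmult_lt_0_compat; lra. }
  exists (Rmin (d / 2) (eps / c)). split.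
  { apply Rmin_glb_lt; [lra|]. now apply Rdiv_lt_0_compat. }
  intros z Hz Hlt.
  assert (H1 : Cmod (z - xi)%C < d / 2) by (eapply Rlt_le_trans; [exact Hlt|apply Rmin_l]).
  assert (H2 : Cmod (z - xi)%C < eps / c) by (eapply Rlt_le_trans; [exact Hlt|apply Rmin_r]).
  apply Rlt_div_r in H2; [|easy].
  eapply Rlt_le_trans; [|apply (one_component_function_near_1 a xi z K (d / 2)); try easy].
  - fold c. lra.
  - lra.
  - intros s. specialize (Havoid _ (HpE s)). lra.
Qed.

(** Approach [t] vertically: [p] fixes the points of [A], so the distance to [A] is [0] and the
    bound [1/10] holds at every height up to [2K]. *)
Lemma one_component_function_small_near (A : R -> Prop) (a : C) (K : R) (p : R -> R) (t delta : R) :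
  Cmod a = 1 -> bounded_monotone K p -> nearest_point_map A p ->
  A t -> 0 < delta ->
  exists z, in_disc z /\ Cmod (z - to_disc a (RtoC t))%C < delta /\
    Cmod (one_component_function a K p z) < exp (- (1 / 20)).
Proof.
  intros Ha Hp HA Ht Hd. assert (HK : 0 < K) by now destruct Hp.
  assert (Hpt : p t = t).
  { destruct (HA t) as [_ H]. specialize (H t Ht). rewrite Rminus_diag, Rabs_R0 in H.
    assert (H0 := Rabs_pos (t - p t)).
    apply Rminus_diag_uniq_sym. apply Rabs_eq_0. lra. }
  (* As [to_disc] is 2-Lipschitz, a height of at most [delta / 4] moves the image by at most
     [delta / 2]. *)
  pose (y := Rmin K (delta / 4)).
  assert (Hy : 0 < y) by (apply Rmin_glb_lt; lra).
  assert (HyK : y <= K) by apply Rmin_l.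
  assert (Hyd : y <= delta / 4) by apply Rmin_r.
  assert (Hdisc : in_disc (to_disc a (t, y))) by (apply to_disc_in_disc; simpl; easy).
  exists (to_disc a (t, y)). split; [easy|]. split.
  - eapply Rle_lt_trans; [apply Cmod_to_disc_minus_le; simpl; lra|].
    assert (H := Cmod_le_fst_snd ((t, y) - RtoC t)%C). simpl in H.
    replace (t + - t) with 0 in H by ring. replace (y + - 0) with y in H by ring.
    rewrite Rabs_R0, (Rabs_pos_eq y) in H by lra. lra.
  - apply sublevel_iff_superlevel; try easy.
    rewrite to_plane_to_disc by (simpl; lra).
    split; simpl; [easy|]. apply Rlt_le_trans with (1 / 10); [lra|].
    apply (potential_ge A); try easy; try lra.
    + rewrite <- Hpt. now apply Hp.
    + rewrite Hpt, Rminus_diag, Rabs_R0. lra.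
Qed.

(** * The empty case, the real trace of [E], and the conclusion *)

Lemma constant_one_component (E : C -> Prop) :
  (forall z, ~ E z) ->
  exists b : C -> C,
    holomorphic_on_disc b /\ sup_norm_one b /\ one_component b /\
    (forall xi, spec b xi <-> E xi).
Proof.
  intros HE. exists (fun _ => RtoC 1).
  assert (Hspec : forall xi, ~ spec (fun _ => RtoC 1) xi).
  { intros xi [_ [c [Hc H]]]. destruct (H 1 Rlt_0_1) as [z [_ [_ Hz]]].
    rewrite Cmod_1 in Hz. lra. }
  repeat split.
  - intros z _. exists (RtoC 0). apply (is_derive_const (V := C_NormedModule)).
  - intros z _. rewrite Cmod_1. lra.
  - intros eps Heps. exists (RtoC 0). unfold in_disc. rewrite Cmod_0, Cmod_1. lra.
  (* The sublevel set of the constant [1] at this threshold is empty, hence connected. *)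
  - exists (1 / 2). repeat split; try lra.
    + intros xi Hxi. now apply Hspec in Hxi.
    + intros [U [V [_ [_ [_ [[z [[_ Hz] _]] _]]]]]]. rewrite Cmod_1 in Hz. lra.
  - intros H. now apply Hspec in H.
  - now apply HE in H.
  - now apply HE in H.
Qed.

Lemma closed_real_trace (E : C -> Prop) (a : C) :
  Cmod a = 1 -> closed (T := C_UniformSpace) E ->
  closed (fun t : R => E (to_disc a (RtoC t))).
Proof.
  intros Ha HE t Ht. apply NNPP. intros Hn. apply Ht.
  destruct (closed_C_avoid E _ HE Hn) as [d [Hd Havoid]].
  assert (Hd2 : 0 < d / 2) by lra.
  exists (mkposreal _ Hd2). intros s Hs HEs.
  change (Rabs (s - t) < d / 2) in Hs.
  specialize (Havoid _ HEs).
  assert (H : Cmod (to_disc a (RtoC s) - to_disc a (RtoC t))%C <= 2 * Cmod (RtoC s - RtoC t)%C).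
  { apply Cmod_to_disc_minus_le; simpl; lra. }
  rewrite <- RtoC_minus, Cmod_R in H. lra.
Qed.

(** Since [|to_disc a t - a| * |t + i| = 2], staying at distance [d] from [a] forces
    [|t| <= |t + i| <= 2 / d]. *)
Lemma bounded_real_trace (E : C -> Prop) (a : C) :
  Cmod a = 1 -> closed (T := C_UniformSpace) E -> ~ E a ->
  exists K, 0 < K /\ forall t, E (to_disc a (RtoC t)) -> Rabs t <= K.
Proof.
  intros Ha HE Hn. destruct (closed_C_avoid E a HE Hn) as [d [Hd Havoid]].
  exists (2 / d). split; [now apply Rdiv_lt_0_compat; [lra|]|].
  intros t Ht. specialize (Havoid _ Ht).
  assert (Hsnd : 0 <= snd (RtoC t)) by (simpl; lra).
  assert (Hne := plus_Ci_neq_0 _ Hsnd).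
  assert (H : Cmod ((to_disc a (RtoC t) - a) * (RtoC t + Ci))%C = 2).
  { replace ((to_disc a (RtoC t) - a) * (RtoC t + Ci))%C with (- (a * (RtoC 2 * Ci)))%C
      by (unfold to_disc; field; easy).
    rewrite Cmod_opp, !Cmod_mult, Ha, Cmod_Ci, Cmod_R, Rabs_pos_eq; lra. }
  rewrite Cmod_mult in H.
  assert (Hf := fst_le_Cmod (RtoC t + Ci)%C). simpl in Hf. rewrite Rplus_0_r in Hf.
  apply Rle_div_r; [easy|]. rewrite <- H, Rmult_comm.
  apply Rmult_le_compat; try easy; [lra|apply Rabs_pos].
Qed.

Theorem theorem1p2 (E : C -> Prop)
  (HE_circle : forall z, E z -> Cmod z = 1)
  (HE_closed : closed E)
  (HE_proper : exists xi, Cmod xi = 1 /\ ~ E xi) :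
  exists b : C -> C,
    holomorphic_on_disc b /\ sup_norm_one b /\ one_component b /\
    (forall xi, spec b xi <-> E xi).
Proof.
  destruct HE_proper as [a [Ha HaE]].
  destruct (classic (exists z, E z)) as [[z0 Hz0]|Hempty].
  2:{ apply constant_one_component. intros z Hz. apply Hempty. now exists z. }
  set (A := fun t : R => E (to_disc a (RtoC t))).
  assert (HEA : forall z, E z -> exists t, z = to_disc a (RtoC t) /\ A t).
  { intros z Hz. destruct (unit_circle_to_disc a z Ha (HE_circle z Hz)) as [t Ht].
    - intros ->. contradiction.
    - exists t. split; [easy|]. unfold A. now rewrite <- Ht. }
  destruct (bounded_real_trace E a Ha HE_closed HaE) as [K [HK HAK]].
  destruct (nearest_point_map_exists A) as [p Hp].
  { destruct (HEA z0 Hz0) as [t [_ Ht]]. now exists t. }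
  { now apply closed_real_trace. }
  assert (Hbm : bounded_monotone K p).
  { split; [easy|]. split; [now apply (nearest_point_map_nondecreasing A)|].
    intros s. apply HAK, Hp. }
  assert (HpE : forall s, E (to_disc a (RtoC (p s)))) by (intros s; apply Hp).
  set (b := one_component_function a K p).
  assert (Hc : exp (- (1 / 20)) < 1) by (rewrite <- exp_0 at 2; apply exp_increasing; lra).
  (* This serves twice: it places [E] in the spectrum, and it gives the closure condition with the
     same threshold. *)
  assert (Hsmall : forall xi, E xi -> forall delta, 0 < delta ->
    exists z, in_disc z /\ Cmod (z - xi)%C < delta /\ Cmod (b z) < exp (- (1 / 20))).
  { intros xi Hxi delta Hdelta. destruct (HEA xi Hxi) as [t [-> Ht]].
    now apply (one_component_function_small_near A). }
  assert (Hspec : forall xi, spec b xi <-> E xi).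
  { intros xi. split.
    - intros [Hxi [c [Hc1 Hliminf]]]. apply NNPP. intros HnE.
      destruct (one_component_function_away E a xi K p (1 - c)) as [d [Hd Haway]]; try assumption.
      { lra. }
      destruct (Hliminf d Hd) as [z [Hz [Hzd Hbz]]].
      specialize (Haway z Hz Hzd). fold b in Haway. lra.
    - intros Hxi. split; [now apply HE_circle|].
      exists (exp (- (1 / 20))). split; [easy|]. now apply Hsmall. }
  exists b. split; [now apply one_component_function_holomorphic|].
  split; [|split; [|exact Hspec]].
  - split; [intros z Hz; now apply one_component_function_le_1|].
    intros eps Heps.
    (* The supremum [1] is approached at [a] itself, which lies outside [E]; the witness is the
       radial point [(1 - r) * a]. *)
    destruct (one_component_function_away E a a K p eps) as [d [Hd Haway]]; try assumption.
    pose (r := Rmin (1 / 2) (d / 2)).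
    assert (Hr : 0 < r) by (apply Rmin_glb_lt; lra).
    assert (Hr1 : r <= 1 / 2) by apply Rmin_l.
    assert (Hr2 : r <= d / 2) by apply Rmin_r.
    assert (Hz : in_disc (RtoC (1 - r) * a)%C).
    { unfold in_disc. rewrite Cmod_mult, Cmod_R, Ha, Rabs_pos_eq; lra. }
    exists (RtoC (1 - r) * a)%C. split; [easy|]. apply Haway; [easy|].
    replace (RtoC (1 - r) * a - a)%C with (- (RtoC r * a))%C by (rewrite RtoC_minus; ring).
    rewrite Cmod_opp, Cmod_mult, Cmod_R, Ha, Rabs_pos_eq; lra.
  - exists (exp (- (1 / 20))). split; [apply exp_pos|]. split; [easy|]. split.
    + intros xi Hxi delta Hdelta. apply Hspec in Hxi.
      destruct (Hsmall xi Hxi delta Hdelta) as [z [Hz [Hzd Hbz]]].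
      exists z. split; [split; [easy|lra]|easy].
    + now apply (sublevel_connected A).
Qed.
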